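(* For every $0<\varepsilon\le 1$ and for each of the types (a), (b), (c) there exists an admissible cutoff function $\hat a$ of that type such that, for every integer $n\ge 1$, the kernel $$L_n(x,y):=\sum_{j=0}^\infty \hat a\Big(\frac{j}{n}\Big)\tilde T_j(x)\tilde T_j(y)$$ satisfies $$|L_n(x,y)|\le c\,n\exp\left\{-\frac{c'\varepsilon\, n\rho(x,y)}{[\ln(e+n\rho(x,y))]^{1+\varepsilon}}\right\},\qquad x,y\in[-1,1],$$ where $c'>0$ is an absolute constant and $c$ depends only on $\varepsilon$.
   Context: The normalized Chebyshev polynomials are $\tilde T_n(x):=\sqrt{2/\pi}\cos(n\arccos x)$ for $n\ge1$ and $\tilde T_0:=\sqrt{1/\pi}$; they form an orthonormal basis of $L^2([-1,1],(1-x^2)^{-1/2}dx)$. The distance on $[-1,1]$ is $\rho(x,y):=|\arccos x-\arccos y|$. A function $\hat a\in C^\infty[0,\infty)$ is an admissible cutoff function of type (a) if $\operatorname{supp}\hat a\subset[0,2]$ and $\hat a(t)=1$ for $t\in[0,1]$; of type (b) if $\operatorname{supp}\hat a\subset[1/2,2]$; of type (c) if $\operatorname{supp}\hat a\subset[1/2,2]$ and $|\hat a(t)|^2+|\hat a(t/2)|^2=1$ for $t\in[1,2]$. *)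

(* Defs.v *)
From Stdlib Require Import Reals Lra.
From Coquelicot Require Import Coquelicot.
Open Scope R_scope.

Definition Ttilde (n : nat) (x : R) : R :=
  match n with
  | O => sqrt (1 / PI)
  | _ => sqrt (2 / PI) * cos (INR n * acos x)
  end.

Definition rho (x y : R) : R := Rabs (acos x - acos y).

Definition smooth (f : R -> R) : Prop := forall (k : nat) (x : R), ex_derive_n f k x.

Inductive cutoff_type := TypeA | TypeB | TypeC.

(* admissible cutoff functions (values on t >= 0 matter; f is given on all of R) *)
Definition admissible (ty : cutoff_type) (a : R -> R) : Prop :=
  smooth a /\
  match ty with
  | TypeA => (forall t, 0 <= t -> a t <> 0 -> t <= 2) /\
             (forall t, 0 <= t <= 1 -> a t = 1)
  | TypeB => (forall t, 0 <= t -> a t <> 0 -> 1/2 <= t <= 2)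
  | TypeC => (forall t, 0 <= t -> a t <> 0 -> 1/2 <= t <= 2) /\
             (forall t, 1 <= t <= 2 -> (Rabs (a t))^2 + (Rabs (a (t/2)))^2 = 1)
  end.

Definition Lker (a : R -> R) (n : nat) (x y : R) : R :=
  Series (fun j : nat => a (INR j / INR n) * Ttilde j x * Ttilde j y).

(* Main.v *)
(* Averaging a ramp successively over intervals of half-widths [d_0, d_1, ...] with
   [sum d_j <= 1/3] gives a smooth step [s] (0 on [t <= 1], 1 on [t >= 2]) whose [k]-th
   derivative is at most [/ (d_0 ... d_(k-1))].  With
   [3 d_j = ln (e+j)^(-eps) - ln (e+j+1)^(-eps)] the sum telescopes and
   [/ d_j = O (j ln (e+j)^(1+eps) / eps)], so up to order [k] the function [s], and then
   [cos] and [sin] of multiples of [s], have derivatives bounded like those of an analytic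
   function of radius [eps / ln (e+k)^(1+eps)].  The cutoffs are [cos (PI/2 s(|t|))] for type
   (a) and [sin (PI/2 s(2|t|)) cos (PI/2 s(|t|))] for types (b) and (c).  With [x = cos al],
   [y = cos be], the kernel is a combination of the two cosine sums at [al - be] and
   [al + be]; summing them by parts [k] times, with [k] the integer part of the exponent in
   the claim, gives the decay. *)
Require Import Defs.
From Stdlib Require Import Reals Lra Lia.
From Coquelicot Require Import Coquelicot.
Open Scope R_scope.

(** * Derivative bounds *)

(** The bound for derivative number [i <= k] is [C * lam^i * p * (p+1) * ... * (p+i-1)], as for an
    analytic function of radius [/ lam]. The order is finite because [lam] will grow with [k]. *)
Fixpoint deriv_bounded (lam : R) (k : nat) (p C : R) (f : R -> R) : Prop :=
  (forall x, Rabs (f x) <= C) /\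
  match k with
  | O => True
  | S k' => exists f', (forall x, is_derive f x (f' x)) /\
                       deriv_bounded lam k' (p + 1) (C * lam * p) f'
  end.

Lemma deriv_bounded_sup lam k p C f :
  deriv_bounded lam k p C f -> forall x, Rabs (f x) <= C.
Proof. destruct k; simpl; intros [H _]; exact H. Qed.

Lemma deriv_bounded_nonneg lam k p C f : deriv_bounded lam k p C f -> 0 <= C.
Proof.
intros H; apply deriv_bounded_sup with (x := 0) in H.
pose proof (Rabs_pos (f 0)); lra.
Qed.

Lemma deriv_bounded_mono lam lam' k p p' C C' f :
  0 <= lam <= lam' -> 0 <= p <= p' -> C <= C' ->
  deriv_bounded lam k p C f -> deriv_bounded lam' k p' C' f.
Proof.
intros Hl; revert p p' C C' f; induction k as [|k IH]; intros p p' C C' f Hp HC H.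
- destruct H as [H _]; split; [intros x; specialize (H x); lra | exact I].
- pose proof (deriv_bounded_nonneg _ _ _ _ _ H) as HC0.
  destruct H as [H [f' [Hd Hf']]]; split; [intros x; specialize (H x); lra |].
  exists f'; split; [exact Hd |].
  apply IH with (p := p + 1) (C := C * lam * p); [lra | | exact Hf'].
  apply Rmult_le_compat; [| lra | | lra].
  + apply Rmult_le_pos; lra.
  + apply Rmult_le_compat; lra.
Qed.

Lemma deriv_bounded_pred lam k p C f :
  deriv_bounded lam (S k) p C f -> deriv_bounded lam k p C f.
Proof.
revert p C f; induction k as [|k IH]; intros p C f [H [f' [Hd Hf']]]; split; auto.
exists f'; auto.
Qed.

Lemma deriv_bounded_scal lam k p C f c :
  deriv_bounded lam k p C f -> deriv_bounded lam k p (Rabs c * C) (fun x => c * f x).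
Proof.
revert p C f; induction k as [|k IH]; intros p C f [H H']; split; auto.
- intros x; rewrite Rabs_mult; apply Rmult_le_compat_l; auto using Rabs_pos.
- intros x; rewrite Rabs_mult; apply Rmult_le_compat_l; auto using Rabs_pos.
- destruct H' as [f' [Hd Hf']]; exists (fun x => c * f' x); split.
  + intros x; apply is_derive_scal; auto.
  + replace (Rabs c * C * lam * p) with (Rabs c * (C * lam * p)) by ring; auto.
Qed.

Lemma deriv_bounded_plus lam k p C D f g :
  deriv_bounded lam k p C f -> deriv_bounded lam k p D g ->
  deriv_bounded lam k p (C + D) (fun x => f x + g x).
Proof.
revert p C D f g; induction k as [|k IH]; intros p C D f g [H H'] [K K'].
- split; auto; intros x; specialize (H x); specialize (K x).
  pose proof (Rabs_triang (f x) (g x)); lra.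
- split.
  { intros x; specialize (H x); specialize (K x).
    pose proof (Rabs_triang (f x) (g x)); lra. }
  destruct H' as [f' [Hd Hf']], K' as [g' [Kd Kg']].
  exists (fun x => f' x + g' x); split.
  + intros x; apply @is_derive_plus; auto.
  + replace ((C + D) * lam * p) with (C * lam * p + D * lam * p) by ring; auto.
Qed.

(* [p (p+1) ... (p+j-1) lam^j] is the [j]-th derivative of [(1 - lam x)^(-p)] at [0];
   multiplying these majorants adds the exponents. *)
Lemma deriv_bounded_mult lam k p q C D f g :
  deriv_bounded lam k p C f -> deriv_bounded lam k q D g ->
  deriv_bounded lam k (p + q) (C * D) (fun x => f x * g x).
Proof.
revert p q C D f g; induction k as [|k IH]; intros p q C D f g Hf Hg.
- destruct Hf as [H _], Hg as [K _]; split; auto.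
  intros x; rewrite Rabs_mult; apply Rmult_le_compat; auto using Rabs_pos.
- pose proof (deriv_bounded_pred _ _ _ _ _ Hf) as Hf0.
  pose proof (deriv_bounded_pred _ _ _ _ _ Hg) as Hg0.
  destruct Hf as [H [f' [Hd Hf']]], Hg as [K [g' [Kd Hg']]]; split.
  { intros x; rewrite Rabs_mult; apply Rmult_le_compat; auto using Rabs_pos. }
  exists (fun x => f' x * g x + f x * g' x); split.
  + intros x; apply (is_derive_mult f g); auto; intros; apply Rmult_comm.
  + replace (C * D * lam * (p + q)) with (C * lam * p * D + C * (D * lam * q)) by ring.
    apply deriv_bounded_plus.
    * replace (p + q + 1) with (p + 1 + q) by ring; auto.
    * replace (p + q + 1) with (p + (q + 1)) by ring; auto.
Qed.

Lemma deriv_bounded_comp_linear lam k p C f c :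
  deriv_bounded lam k p C f ->
  deriv_bounded (Rabs c * lam) k p C (fun x => f (c * x)).
Proof.
revert p C f; induction k as [|k IH]; intros p C f [H H']; split; auto.
destruct H' as [f' [Hd Hf']]; exists (fun x => c * f' (c * x)); split.
- intros x; apply (is_derive_comp f (fun x => c * x)); auto.
  auto_derive; auto; ring.
- replace (C * (Rabs c * lam) * p) with (Rabs c * (C * lam * p)) by ring.
  apply deriv_bounded_scal, IH, Hf'.
Qed.

Lemma deriv_bounded_shift lam k p C f c :
  deriv_bounded lam k p C f -> deriv_bounded lam k p C (fun x => f (x + c)).
Proof.
revert p C f; induction k as [|k IH]; intros p C f [H H']; split; auto.
destruct H' as [f' [Hd Hf']]; exists (fun x => f' (x + c)); split; auto.
intros x; replace (f' (x + c)) with (1 * f' (x + c)) by ring.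
apply (is_derive_comp f (fun x => x + c)); auto.
auto_derive; auto; ring.
Qed.

(* [cos f] and [sin f] are controlled together through the system
   [(cos f)' = - f' sin f], [(sin f)' = f' cos f]. *)
Lemma deriv_bounded_cos_sin lam k C f f' :
  0 <= lam -> C <= lam -> (forall x, is_derive f x (f' x)) ->
  (forall j, S j = k -> deriv_bounded lam j 1 C f') ->
  deriv_bounded lam k 1 1 (fun x => cos (f x)) /\
  deriv_bounded lam k 1 1 (fun x => sin (f x)).
Proof.
intros Hl HC Hd.
assert (Bc : forall x, Rabs (cos (f x)) <= 1).
{ intros x; apply Rabs_le; pose proof (COS_bound (f x)); lra. }
assert (Bs : forall x, Rabs (sin (f x)) <= 1).
{ intros x; apply Rabs_le; pose proof (SIN_bound (f x)); lra. }
induction k as [|k IH]; intros Hf'; [repeat split; auto |].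
specialize (Hf' k eq_refl).
destruct IH as [IHc IHs].
{ intros j <-; apply deriv_bounded_pred, Hf'. }
pose proof (deriv_bounded_nonneg _ _ _ _ _ Hf').
split; (split; [auto |]).
- exists (fun x => -1 * (f' x * sin (f x))); split.
  + intros x; replace (-1 * (f' x * sin (f x))) with (f' x * - sin (f x)) by ring.
    apply (is_derive_comp cos f); auto; apply is_derive_cos.
  (* Both factors have exponent 1, so the product has exponent [1 + 1], as required of the
     derivative of a function of exponent 1; [C <= lam] settles the constant. *)
  + apply deriv_bounded_mono with lam (1 + 1) (Rabs (-1) * (C * 1)); try lra.
    { rewrite Rabs_left; lra. }
    apply deriv_bounded_scal, deriv_bounded_mult; auto.
- exists (fun x => f' x * cos (f x)); split.
  + intros x; apply (is_derive_comp sin f); auto; apply is_derive_sin.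
  + apply deriv_bounded_mono with lam (1 + 1) (C * 1); try lra.
    apply deriv_bounded_mult; auto.
Qed.

Lemma is_derive_continuous (f f' : R -> R) :
  (forall x, is_derive f x (f' x)) -> forall x, continuous f x.
Proof. intros Hd x; apply (ex_derive_continuous f); exists (f' x); apply Hd. Qed.

Lemma is_derive_lipschitz (f f' : R -> R) (C : R) :
  (forall x, is_derive f x (f' x)) -> (forall x, Rabs (f' x) <= C) ->
  forall x y, Rabs (f x - f y) <= C * Rabs (x - y).
Proof.
intros Hd HC x y.
destruct (MVT_gen f y x f') as [c [_ ->]]; auto.
{ intros z _; apply continuity_pt_filterlim, (is_derive_continuous f f' Hd). }
rewrite Rabs_mult; apply Rmult_le_compat_r; auto using Rabs_pos.
Qed.

(** By the mean value theorem, applied at each order, the difference obeys the same bounds as [h]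
    times the derivative. Each summation by parts will use this once, at the cost of one order. *)
Lemma deriv_bounded_difference lam k p C f h :
  0 <= h -> deriv_bounded lam (S k) p C f ->
  deriv_bounded lam k (p + 1) (h * (C * lam * p)) (fun x => f (x - h) - f x).
Proof.
intros Hh; revert p C f; induction k as [|k IH]; intros p C f [H [f' [Hd Hf']]].
- split; auto; intros x.
  replace h with (Rabs (x - h - x)) at 2.
  2:{ replace (x - h - x) with (- h) by ring; rewrite Rabs_Ropp; apply Rabs_pos_eq, Hh. }
  rewrite Rmult_comm.
  apply (is_derive_lipschitz f f'); auto; apply (deriv_bounded_sup _ _ _ _ _ Hf').
- split.
  + intros x.
    replace h with (Rabs (x - h - x)) at 2.
    2:{ replace (x - h - x) with (- h) by ring; rewrite Rabs_Ropp; apply Rabs_pos_eq, Hh. }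
    rewrite Rmult_comm.
    apply (is_derive_lipschitz f f'); auto; apply (deriv_bounded_sup _ _ _ _ _ Hf').
  + exists (fun x => f' (x - h) - f' x); split.
    * intros x; apply @is_derive_minus; auto.
      replace (f' (x - h)) with (1 * f' (x - h)) by ring.
      apply (is_derive_comp f (fun x => x - h)); auto.
      auto_derive; auto; ring.
    * replace (h * (C * lam * p) * lam * (p + 1))
        with (h * (C * lam * p * lam * (p + 1))) by ring.
      apply IH, Hf'.
Qed.

Lemma ex_derive_n_S (f f' : R -> R) k :
  (forall x, is_derive f x (f' x)) -> (forall x, ex_derive_n f' k x) ->
  forall x, ex_derive_n f (S k) x.
Proof.
intros Hd Hf'; destruct k as [|k]; intros x.
{ exists (f' x); apply Hd. }
apply ex_derive_ext with (Derive_n f' k); [| apply Hf'].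
intros y; rewrite <- (Nat.add_1_r k), <- Derive_n_comp.
apply Derive_n_ext; intros z; symmetry; apply is_derive_unique, Hd.
Qed.

Lemma deriv_bounded_ex_derive_n lam k p C f :
  deriv_bounded lam k p C f -> forall x, ex_derive_n f k x.
Proof.
revert p C f; induction k as [|k IH]; intros p C f H; [intros x; exact I |].
destruct H as [_ [f' [Hd Hf']]]; apply ex_derive_n_S with f'; eauto.
Qed.

(** * Iterated averages *)

Definition lipschitz (L : R) (f : R -> R) : Prop :=
  forall x y, Rabs (f x - f y) <= L * Rabs (x - y).

Lemma lipschitz_continuous L f : lipschitz L f -> forall x, continuous f x.
Proof.
intros Hf x; apply filterlim_locally; intros e.
(* No sign is assumed for [L]; [Rabs L + 1] is a safe positive divisor. *)
assert (HL : 0 < Rabs L + 1) by (pose proof (Rabs_pos L); lra).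
assert (He : 0 < e / (Rabs L + 1)) by (apply Rdiv_lt_0_compat; [apply cond_pos | lra]).
exists (mkposreal _ He); intros y Hy.
change (Rabs (y - x) < e / (Rabs L + 1)) in Hy.
change (Rabs (f y - f x) < e).
apply Rle_lt_trans with ((Rabs L + 1) * Rabs (y - x)).
- apply Rle_trans with (1 := Hf y x), Rmult_le_compat_r; [apply Rabs_pos |].
  pose proof (Rle_abs L); lra.
- apply Rmult_lt_compat_l with (r := Rabs L + 1) in Hy; [| lra].
  replace ((Rabs L + 1) * (e / (Rabs L + 1))) with (pos e) in Hy by (field; lra).
  exact Hy.
Qed.

Lemma continuous_ex_RInt (f : R -> R) a b :
  (forall x, continuous f x) -> ex_RInt f a b.
Proof. intros Hf; apply (ex_RInt_continuous (V := R_CompleteNormedModule)); auto. Qed.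

Definition average (d : R) (f : R -> R) (x : R) : R :=
  / (2 * d) * RInt f (x - d) (x + d).

Lemma average_const d c x : 0 < d -> average d (fun _ => c) x = c.
Proof.
intros Hd; unfold average; rewrite RInt_const; unfold scal; simpl; unfold mult; simpl.
field; lra.
Qed.

Lemma average_le d f g x :
  0 < d -> (forall y, continuous f y) -> (forall y, continuous g y) ->
  (forall t, Rabs (t - x) <= d -> f t <= g t) -> average d f x <= average d g x.
Proof.
intros Hd Hf Hg H; unfold average; apply Rmult_le_compat_l.
{ left; apply Rinv_0_lt_compat; lra. }
apply RInt_le; [lra | apply continuous_ex_RInt; auto | apply continuous_ex_RInt; auto |].
intros t Ht; apply H, Rabs_le; lra.
Qed.

Lemma average_bounds d f x a b :
  0 < d -> (forall y, continuous f y) ->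
  (forall t, Rabs (t - x) <= d -> a <= f t <= b) -> a <= average d f x <= b.
Proof.
intros Hd Hf H; split.
- rewrite <- (average_const d a x Hd); apply average_le; auto.
  + intros y; apply continuous_const.
  + intros t Ht; apply H, Ht.
- rewrite <- (average_const d b x Hd); apply average_le; auto.
  + intros y; apply continuous_const.
  + intros t Ht; apply H, Ht.
Qed.

Lemma average_minus d f g x :
  (forall y, continuous f y) -> (forall y, continuous g y) ->
  average d (fun t => f t - g t) x = average d f x - average d g x.
Proof.
intros Hf Hg; unfold average.
rewrite (RInt_minus f g) by (apply continuous_ex_RInt; auto).
unfold minus, plus, opp; simpl; ring.
Qed.

Lemma average_close d f g x e :
  0 < d -> (forall y, continuous f y) -> (forall y, continuous g y) ->
  (forall t, Rabs (f t - g t) <= e) -> Rabs (average d f x - average d g x) <= e.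
Proof.
intros Hd Hf Hg H; rewrite <- average_minus; auto.
apply Rabs_le, average_bounds; auto.
- intros y; apply (continuous_minus f g); auto.
- intros t _; apply Rabs_le_between, H.
Qed.

Lemma is_derive_average d f x :
  0 < d -> (forall y, continuous f y) ->
  is_derive (average d f) x (/ (2 * d) * (f (x + d) - f (x - d))).
Proof.
intros Hd Hf; apply (is_derive_scal (fun x => RInt f (x - d) (x + d))).
replace (f (x + d) - f (x - d)) with (minus (scal 1 (f (x + d))) (scal 1 (f (x - d)))).
2:{ unfold minus, plus, opp, scal; simpl; unfold mult; simpl; ring. }
apply (is_derive_RInt_bound_comp f (RInt f) (fun x => x - d) (fun x => x + d)).
- apply filter_forall; intros ab; apply (RInt_correct f), continuous_ex_RInt, Hf.
- apply Hf.
- apply Hf.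
- auto_derive; auto; ring.
- auto_derive; auto; ring.
Qed.

Lemma lipschitz_average d L f : 0 < d -> lipschitz L f -> lipschitz L (average d f).
Proof.
intros Hd Hf.
unfold lipschitz.
apply (is_derive_lipschitz (average d f) (fun x => / (2 * d) * (f (x + d) - f (x - d)))).
- intros x; apply is_derive_average; auto; apply (lipschitz_continuous L), Hf.
- intros x; rewrite Rabs_mult, Rabs_pos_eq by (left; apply Rinv_0_lt_compat; lra).
  apply Rmult_le_reg_l with (2 * d); [lra |].
  rewrite <- Rmult_assoc, Rinv_r, Rmult_1_l by lra.
  apply Rle_trans with (1 := Hf _ _).
  replace (x + d - (x - d)) with (2 * d) by ring.
  rewrite Rabs_pos_eq by lra; lra.
Qed.

(* The half-width of the [j]-th average is the telescoping difference [tau j - tau (j+1)];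
   [averages tau f N k] performs the averages number [k], ..., [k+N-1]. *)
Fixpoint averages (tau : nat -> R) (f : R -> R) (N k : nat) : R -> R :=
  match N with
  | O => f
  | S N' => average (tau k - tau (S k)) (averages tau f N' (S k))
  end.

(** The starting index [k] is kept because the derivative of the limit from [k] is a difference
    quotient of the limit from [k + 1]. That the limit is finite, so that [real] loses nothing, is
    part of the proof of [averages_lim_error]. *)
Definition averages_lim (tau : nat -> R) (f : R -> R) (k : nat) (x : R) : R :=
  real (Lim_seq (fun N => averages tau f N k x)).

Lemma lipschitz_averages tau L f N k :
  (forall j, tau (S j) < tau j) -> lipschitz L f -> lipschitz L (averages tau f N k).
Proof.
intros Ht Hf; revert k; induction N as [|N IH]; intros k; simpl; auto.
apply lipschitz_average; auto; specialize (Ht k); lra.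
Qed.

(** Each average looks as far as its half-width, and the half-widths number [k] to [k + N - 1]
    telescope. *)
Lemma averages_bounds tau L f N k x a b :
  (forall j, tau (S j) < tau j) -> lipschitz L f ->
  (forall t, Rabs (t - x) <= tau k - tau (k + N)%nat -> a <= f t <= b) ->
  a <= averages tau f N k x <= b.
Proof.
intros Ht Hf; revert k x; induction N as [|N IH]; intros k x H; simpl.
- apply H; rewrite Nat.add_0_r, !Rminus_diag, Rabs_R0; lra.
- pose proof (Ht k); apply average_bounds; [lra | |].
  + apply (lipschitz_continuous L), lipschitz_averages; auto.
  + intros t Htx; apply IH; intros s Hs; apply H.
    replace (k + S N)%nat with (S k + N)%nat by lia.
    replace (s - x) with ((s - t) + (t - x)) by ring.
    pose proof (Rabs_triang (s - t) (t - x)); lra.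
Qed.

(** The additional average is the innermost one: it moves a Lipschitz [f] by at most [L] times its
    half-width, and the outer averages do not enlarge a uniform error. *)
Lemma averages_succ tau L f N k x :
  (forall j, tau (S j) < tau j) -> 0 <= L -> lipschitz L f ->
  Rabs (averages tau f (S N) k x - averages tau f N k x)
    <= L * (tau (k + N)%nat - tau (S (k + N))).
Proof.
intros Ht HL Hf; revert k x; induction N as [|N IH]; intros k x.
- rewrite Nat.add_0_r; pose proof (Ht k).
  assert (E : f x - L * (tau k - tau (S k)) <= average (tau k - tau (S k)) f x
              <= f x + L * (tau k - tau (S k))).
  { apply average_bounds; [lra | apply (lipschitz_continuous L), Hf |].
    intros t Htx.
    assert (Rabs (f t - f x) <= L * (tau k - tau (S k))).
    { apply Rle_trans with (1 := Hf t x), Rmult_le_compat_l; auto. }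
    apply Rabs_le_between in H0; lra. }
  simpl; apply Rabs_le; lra.
- replace (k + S N)%nat with (S k + N)%nat by lia.
  pose proof (Ht k); apply average_close; [lra | | | intros t; apply IH].
  + apply (lipschitz_continuous L), (lipschitz_averages tau L f (S N)); auto.
  + apply (lipschitz_continuous L), lipschitz_averages; auto.
Qed.

Lemma is_lim_seq_tail tau (l : R) k :
  is_lim_seq tau l -> is_lim_seq (fun N => tau (k + N)%nat) l.
Proof.
intros H; apply is_lim_seq_ext with (fun N => tau (N + k)%nat).
- intros N; f_equal; lia.
- apply -> (is_lim_seq_incr_n tau k); auto.
Qed.

Lemma le_of_vanishing_error tau a b c k :
  is_lim_seq tau 0 -> (forall N, a <= b + c * tau (k + N)%nat) -> a <= b.
Proof.
intros Hl H.
apply (is_lim_seq_le (fun _ => a) (fun N => b + c * tau (k + N)%nat) a b); auto.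
- apply is_lim_seq_const.
- replace b with (b + c * 0) at 1 by ring.
  apply is_lim_seq_plus'; [apply is_lim_seq_const |].
  apply (is_lim_seq_scal_l (fun N => tau (k + N)%nat) c 0), is_lim_seq_tail, Hl.
Qed.

(** The increments of [u] are dominated by the decrements of [v], so [u + v] decreases and [u - v]
    increases; both tend to the limit of [u], which they enclose. *)
Lemma averages_lim_error tau L f k N x :
  (forall j, tau (S j) < tau j) -> is_lim_seq tau 0 -> 0 <= L -> lipschitz L f ->
  Rabs (averages_lim tau f k x - averages tau f N k x) <= L * tau (k + N)%nat.
Proof.
intros Ht Hl HL Hf.
pose (u := fun N => averages tau f N k x).
pose (v := fun N => L * tau (k + N)%nat).
assert (Hv : is_lim_seq v 0).
{ replace 0 with (L * 0) by ring.
  apply (is_lim_seq_scal_l (fun N => tau (k + N)%nat) L 0), is_lim_seq_tail, Hl. }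
assert (Hs : forall n, Rabs (u (S n) - u n) <= v n - v (S n)).
{ intros n; unfold u, v; rewrite <- Rmult_minus_distr_l, Nat.add_succ_r.
  apply averages_succ; auto. }
assert (Hdec : forall n, u (S n) + v (S n) <= u n + v n).
{ intros n; specialize (Hs n); apply Rabs_le_between in Hs; lra. }
assert (Hinc : forall n, u n - v n <= u (S n) - v (S n)).
{ intros n; specialize (Hs n); apply Rabs_le_between in Hs; lra. }
assert (Hpos : forall n, 0 <= v n).
{ intros n; apply (is_lim_seq_decr_compare v 0); auto.
  intros m; specialize (Hs m); pose proof (Rabs_pos (u (S m) - u m)); lra. }
destruct (ex_finite_lim_seq_decr (fun n => u n + v n) (u O - v O)) as [l Hul].
{ exact Hdec. }
{ intros n; apply Rle_trans with (u n - v n).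
  - induction n as [|n IH]; [lra | specialize (Hinc n); lra].
  - specialize (Hpos n); lra. }
assert (Hu : is_lim_seq u l).
{ apply is_lim_seq_ext with (fun n => (u n + v n) - v n); [intros n; ring |].
  replace l with (l - 0) by ring; apply is_lim_seq_minus'; auto. }
unfold averages_lim; fold u; rewrite (is_lim_seq_unique u l Hu); simpl.
fold (u N); fold (v N).
apply Rabs_le; split.
- cut (u N - v N <= l); [lra |].
  apply (is_lim_seq_incr_compare (fun n => u n - v n)); auto.
  replace l with (l - 0) by ring; apply is_lim_seq_minus'; auto.
- cut (l <= u N + v N); [lra |].
  apply (is_lim_seq_decr_compare (fun n => u n + v n)); auto.
Qed.

Lemma lipschitz_averages_lim tau L f k :
  (forall j, tau (S j) < tau j) -> is_lim_seq tau 0 -> 0 <= L -> lipschitz L f ->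
  lipschitz L (averages_lim tau f k).
Proof.
intros Ht Hl HL Hf x y.
apply (le_of_vanishing_error tau _ _ (2 * L) k Hl); intros N.
pose proof (averages_lim_error tau L f k N x Ht Hl HL Hf) as Hx.
pose proof (averages_lim_error tau L f k N y Ht Hl HL Hf) as Hy.
pose proof (lipschitz_averages tau L f N k Ht Hf x y) as Hxy.
apply Rabs_le_between in Hx; apply Rabs_le_between in Hy; apply Rabs_le_between in Hxy.
apply Rabs_le; lra.
Qed.

Lemma averages_lim_bounds tau L f k x a b :
  (forall j, tau (S j) < tau j) -> is_lim_seq tau 0 -> 0 <= L -> lipschitz L f ->
  (forall t, Rabs (t - x) <= tau k -> a <= f t <= b) ->
  a <= averages_lim tau f k x <= b.
Proof.
intros Ht Hl HL Hf H.
assert (HN : forall N, a <= averages tau f N k x <= b).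
{ intros N; apply averages_bounds with L; auto.
  intros t Htx; apply H.
  (* A decreasing sequence with limit 0 is nonnegative, so [tau k - tau (k + N) <= tau k]. *)
  pose proof (is_lim_seq_decr_compare tau 0 Hl (fun n => Rlt_le _ _ (Ht n)) (k + N)); lra. }
split; apply (le_of_vanishing_error tau _ _ L k Hl); intros N;
  pose proof (averages_lim_error tau L f k N x Ht Hl HL Hf) as Hx;
  apply Rabs_le_between in Hx; specialize (HN N); lra.
Qed.

(** The convergence is uniform and averaging preserves uniform errors, so the outermost average can
    be taken after the limit. *)
Lemma averages_lim_average tau L f k x :
  (forall j, tau (S j) < tau j) -> is_lim_seq tau 0 -> 0 <= L -> lipschitz L f ->
  averages_lim tau f k x = average (tau k - tau (S k)) (averages_lim tau f (S k)) x.
Proof.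
intros Ht Hl HL Hf; pose proof (Ht k).
assert (E : forall N, Rabs (averages_lim tau f k x -
   average (tau k - tau (S k)) (averages_lim tau f (S k)) x) <= 0 + 2 * L * tau (S k + N)%nat).
{ intros N.
  pose proof (averages_lim_error tau L f k (S N) x Ht Hl HL Hf) as Hx.
  replace (k + S N)%nat with (S k + N)%nat in Hx by lia.
  assert (Hy : Rabs (average (tau k - tau (S k)) (averages_lim tau f (S k)) x
           - averages tau f (S N) k x) <= L * tau (S k + N)%nat).
  { apply average_close; [lra | | |].
    - apply (lipschitz_continuous L), lipschitz_averages_lim; auto.
    - apply (lipschitz_continuous L), lipschitz_averages; auto.
    - intros t; apply averages_lim_error; auto. }
  apply Rabs_le_between in Hx; apply Rabs_le_between in Hy; apply Rabs_le; lra. }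
apply le_of_vanishing_error in E; auto.
pose proof (Rabs_pos (averages_lim tau f k x -
   average (tau k - tau (S k)) (averages_lim tau f (S k)) x)).
apply Rminus_diag_uniq, Rabs_eq_0; lra.
Qed.

(** The difference quotient obtained by differentiating the outermost average. It is spelled with
    [-1 *] and [+ -] to match the lemmas on scaling, sums and shifts. *)
Definition averages_lim_deriv (tau : nat -> R) (f : R -> R) (k : nat) (x : R) : R :=
  / (2 * (tau k - tau (S k))) *
  (averages_lim tau f (S k) (x + (tau k - tau (S k)))
   + -1 * averages_lim tau f (S k) (x + - (tau k - tau (S k)))).

Lemma is_derive_averages_lim tau L f k x :
  (forall j, tau (S j) < tau j) -> is_lim_seq tau 0 -> 0 <= L -> lipschitz L f ->
  is_derive (averages_lim tau f k) x (averages_lim_deriv tau f k x).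
Proof.
intros Ht Hl HL Hf; unfold averages_lim_deriv.
apply is_derive_ext with (average (tau k - tau (S k)) (averages_lim tau f (S k))).
{ intros t; symmetry; apply averages_lim_average with L; auto. }
set (d := tau k - tau (S k)).
replace (averages_lim tau f (S k) (x + d) + -1 * averages_lim tau f (S k) (x + - d))
  with (averages_lim tau f (S k) (x + d) - averages_lim tau f (S k) (x - d))
  by (unfold Rminus; ring).
apply is_derive_average; [specialize (Ht k); unfold d; lra |].
apply (lipschitz_continuous L), lipschitz_averages_lim; auto.
Qed.

Lemma deriv_bounded_averages_lim_deriv tau L f lam m k p :
  (forall j, tau (S j) < tau j) -> is_lim_seq tau 0 -> 0 <= L -> lipschitz L f ->
  deriv_bounded lam m p 1 (averages_lim tau f (S k)) ->
  deriv_bounded lam m p (/ (tau k - tau (S k))) (averages_lim_deriv tau f k).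
Proof.
intros Ht Hl HL Hf H; pose proof (Ht k).
replace (/ (tau k - tau (S k)))
  with (Rabs (/ (2 * (tau k - tau (S k)))) * (1 + Rabs (-1) * 1)).
- apply deriv_bounded_scal, deriv_bounded_plus.
  + apply deriv_bounded_shift, H.
  + apply deriv_bounded_scal.
    apply (deriv_bounded_shift lam m p 1 (averages_lim tau f (S k))), H.
- rewrite Rabs_pos_eq by (left; apply Rinv_0_lt_compat; lra).
  rewrite Rabs_left by lra; field; lra.
Qed.

(** Each derivative divides by the next half-width, and the product of the bounds [lam * INR j] for
    [j = k, k+1, ...] is the rising product with [p = INR k]. *)
Lemma deriv_bounded_averages_lim tau L f lam m k :
  (forall j, tau (S j) < tau j) -> is_lim_seq tau 0 -> 0 <= L -> lipschitz L f ->
  0 <= lam -> (forall t, 0 <= f t <= 1) ->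
  (forall j, (k <= j < k + m)%nat -> / (tau j - tau (S j)) <= lam * INR j) ->
  deriv_bounded lam m (INR k) 1 (averages_lim tau f k).
Proof.
intros Ht Hl HL Hf Hlam H01; revert k; induction m as [|m IH]; intros k Hk;
  (assert (Hs : forall x, Rabs (averages_lim tau f k x) <= 1);
   [intros x; pose proof (averages_lim_bounds tau L f k x 0 1 Ht Hl HL Hf
      (fun t _ => H01 t)); apply Rabs_le; lra | split; [exact Hs |]]).
- exact I.
- exists (averages_lim_deriv tau f k); split.
  + intros x; apply is_derive_averages_lim with L; auto.
  + apply deriv_bounded_mono with lam (INR (S k)) (/ (tau k - tau (S k))).
    * lra.
    * rewrite S_INR; pose proof (pos_INR k); lra.
    * rewrite Rmult_1_l; apply Hk; lia.
    * apply deriv_bounded_averages_lim_deriv with L; auto.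
      apply IH; intros j Hj; apply Hk; lia.
Qed.

(** * Cosine sums and the kernel *)

(** The factor [2 sin (theta / 2)] turns each cosine into a difference of two sines; the shift by
    [PI / 2] rewrites these as cosines, so that the formula can be iterated with a new phase. *)
Lemma sum_cos_by_parts (b : R -> R) theta phi N :
  2 * sin (theta / 2) * sum_f_R0 (fun j => b (INR j) * cos (INR j * theta + phi)) N =
  sum_f_R0 (fun j => (b (INR j - 1) - b (INR j)) *
                     cos (INR j * theta + (phi - theta / 2 - PI / 2))) N
  + b (INR N) * cos (INR (S N) * theta + (phi - theta / 2 - PI / 2))
  - b (-1) * cos (phi - theta / 2 - PI / 2).
Proof.
assert (Hstep : forall j, 2 * sin (theta / 2) * cos (INR j * theta + phi) =
  cos (INR (S j) * theta + (phi - theta / 2 - PI / 2))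
  - cos (INR j * theta + (phi - theta / 2 - PI / 2))).
{ intros j; rewrite S_INR.
  replace ((INR j + 1) * theta + (phi - theta / 2 - PI / 2))
    with (- (PI / 2 - ((INR j * theta + phi) + theta / 2))) by lra.
  replace (INR j * theta + (phi - theta / 2 - PI / 2))
    with (- (PI / 2 - ((INR j * theta + phi) - theta / 2))) by lra.
  rewrite !cos_neg, !cos_shift, sin_plus, sin_minus; ring. }
induction N as [|N IH]; [| rewrite !tech5].
- specialize (Hstep O); simpl in Hstep |- *.
  replace (2 * sin (theta / 2) * (b 0 * cos (0 * theta + phi)))
    with (b 0 * (2 * sin (theta / 2) * cos (0 * theta + phi))) by ring.
  rewrite Hstep.
  replace (0 * theta + (phi - theta / 2 - PI / 2)) with (phi - theta / 2 - PI / 2) by ring.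
  replace (0 - 1) with (-1) by ring; ring.
- rewrite Rmult_plus_distr_l, IH.
  replace (2 * sin (theta / 2) * (b (INR (S N)) * cos (INR (S N) * theta + phi)))
    with (b (INR (S N)) * (2 * sin (theta / 2) * cos (INR (S N) * theta + phi))) by ring.
  rewrite Hstep.
  replace (INR (S N) - 1) with (INR N) by (rewrite S_INR; ring); ring.
Qed.

(** Induction on the number of summations by parts. Each one replaces [f] by its backward
    difference, lengthens the range by one node and produces a factor [h * lam] times the current
    exponent; [q] dominates all the exponents that occur. *)
Lemma deriv_bounded_sum_cos lam k p q C f theta phi t0 h N :
  0 <= lam -> 0 <= p -> p + INR k <= q -> 0 <= h -> deriv_bounded lam k p C f ->
  (forall t, t <= t0 -> f t = 0) -> (forall t, t0 + INR N * h <= t -> f t = 0) ->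
  Rabs (2 * sin (theta / 2)) ^ k *
    Rabs (sum_f_R0 (fun j => f (t0 + INR j * h) * cos (INR j * theta + phi)) N)
  <= (INR N + 1 + INR k) * C * (h * lam * q) ^ k.
Proof.
intros Hl Hp Hq Hh; revert p C f phi N Hp Hq.
induction k as [|k IH]; intros p C f phi N Hp Hq Hf H0 HN.
- simpl; rewrite Rmult_1_l, Rmult_1_r, Rplus_0_r.
  apply Rle_trans with (1 := Rsum_abs _ _).
  rewrite (Rmult_comm _ C), <- S_INR, <- sum_cte.
  apply sum_Rle; intros j _; rewrite Rabs_mult, <- (Rmult_1_r C).
  apply Rmult_le_compat; auto using Rabs_pos.
  + apply (deriv_bounded_sup _ _ _ _ _ Hf).
  + apply Rabs_le; pose proof (COS_bound (INR j * theta + phi)); lra.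
- rewrite S_INR in Hq.
  simpl; rewrite (Rmult_comm (Rabs (2 * sin (theta / 2)))), Rmult_assoc, <- Rabs_mult.
  rewrite (sum_cos_by_parts (fun j => f (t0 + j * h))).
  rewrite (H0 (t0 + -1 * h)) by lra.
  (* The boundary term at [N] becomes summand number [N + 1], so that the range fits the support of
     the difference, which extends further by [h]. The left boundary term has just vanished. *)
  match goal with |- _ * Rabs ?X <= _ =>
    replace X with (sum_f_R0 (fun j => (f ((t0 + INR j * h) - h) - f (t0 + INR j * h))
      * cos (INR j * theta + (phi - theta / 2 - PI / 2))) (S N)) end.
  2:{ rewrite tech5, (HN (t0 + INR (S N) * h)) by (rewrite S_INR; lra).
      replace (t0 + INR (S N) * h - h) with (t0 + INR N * h) by (rewrite S_INR; ring).
      rewrite (sum_eq _ (fun j => (f (t0 + (INR j - 1) * h) - f (t0 + INR j * h))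
        * cos (INR j * theta + (phi - theta / 2 - PI / 2)))); [ring |].
      intros j _; f_equal; f_equal; f_equal; ring. }
  pose proof (deriv_bounded_nonneg _ _ _ _ _ Hf) as HC.
  pose proof (pos_INR k) as Hk.
  apply Rle_trans with ((INR (S N) + 1 + INR k) * (h * (C * lam * p)) * (h * lam * q) ^ k).
  + apply (IH (p + 1) (h * (C * lam * p)) (fun t => f (t - h) - f t)); [lra | lra | | |].
    * apply deriv_bounded_difference; auto.
    * intros t Ht; rewrite !H0 by lra; ring.
    * intros t Ht; rewrite S_INR in Ht; rewrite !HN by lra; ring.
  + rewrite S_INR; change (match k with 0%nat => 1 | S _ => INR k + 1 end) with (INR (S k)).
    rewrite S_INR.
    replace (INR N + 1 + 1 + INR k) with (INR N + 1 + (INR k + 1)) by ring.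
    rewrite !Rmult_assoc; apply Rmult_le_compat_l; [pose proof (pos_INR N); lra |].
    rewrite <- !Rmult_assoc; apply Rmult_le_compat_r.
    { apply pow_le; repeat apply Rmult_le_pos; lra. }
    replace (h * C * lam * p) with (C * h * lam * p) by ring.
    apply Rmult_le_compat_l; [repeat apply Rmult_le_pos; lra | lra].
Qed.

Lemma sum_even (F : R -> R) m :
  (forall t, F (- t) = F t) ->
  sum_f_R0 (fun j => F (INR j - INR m)) (2 * m) = 2 * sum_f_R0 (fun j => F (INR j)) m - F 0.
Proof.
intros HF; induction m as [|m IH].
- simpl; rewrite Rminus_0_r; ring.
- replace (2 * S m)%nat with (S (S (2 * m))) by lia.
  rewrite tech5, decomp_sum, Nat.pred_succ by lia.
  rewrite (sum_eq _ (fun j => F (INR j - INR m))).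
  2:{ intros j _; f_equal; rewrite !S_INR; ring. }
  rewrite IH, tech5.
  replace (INR 0 - INR (S m)) with (- INR (S m)) by (simpl (INR 0); ring).
  replace (INR (S (S (2 * m))) - INR (S m)) with (INR (S m))
    by (rewrite !S_INR, mult_INR; simpl (INR 2); ring).
  rewrite HF; ring.
Qed.

Lemma Series_finite (u : nat -> R) N :
  (forall j, (N < j)%nat -> u j = 0) -> Series u = sum_f_R0 u N.
Proof.
intros Hu; apply is_series_unique, is_series_Reals.
intros e He; exists N; intros n Hn.
assert (E : sum_f_R0 u n = sum_f_R0 u N).
{ induction Hn as [|n Hn IH]; auto; simpl; rewrite IH, Hu by lia; ring. }
rewrite E; unfold Rdist; rewrite Rminus_diag, Rabs_R0; exact He.
Qed.

Lemma Ttilde_mult j x y : (1 <= j)%nat ->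
  Ttilde j x * Ttilde j y =
  / PI * (cos (INR j * (acos x - acos y)) + cos (INR j * (acos x + acos y))).
Proof.
intros Hj; destruct j as [|j]; [lia |]; unfold Ttilde.
pose proof PI_RGT_0 as HPI.
rewrite (Rmult_minus_distr_l (INR (S j))), (Rmult_plus_distr_l (INR (S j))), cos_minus, cos_plus.
set (A := cos _); set (B := cos _).
replace (sqrt (2 / PI) * A * (sqrt (2 / PI) * B))
  with (sqrt (2 / PI) * sqrt (2 / PI) * (A * B)) by ring.
rewrite sqrt_sqrt by (left; apply Rdiv_lt_0_compat; lra).
field; lra.
Qed.

(* For even [a], the sum of [a (j / n) cos (j theta)] over all integers [|j| <= 2 n]. *)
Definition cosine_sum (a : R -> R) (n : nat) (theta : R) : R :=
  2 * sum_f_R0 (fun j => a (INR j / INR n) * cos (INR j * theta)) (2 * n) - a 0.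

(** The product formula for cosines handles [j >= 1]. The different normalization of [Ttilde 0]
    agrees with counting index 0 once in the symmetric sums. *)
Lemma Lker_cosine_sum a n x y :
  (1 <= n)%nat -> (forall t, 2 <= t -> a t = 0) ->
  Lker a n x y =
  / (2 * PI) * (cosine_sum a n (acos x - acos y) + cosine_sum a n (acos x + acos y)).
Proof.
intros Hn Ha; pose proof PI_RGT_0 as HPI.
assert (Hn' : 0 < INR n) by (apply lt_0_INR; lia).
unfold Lker; rewrite (Series_finite _ (2 * n)).
2:{ intros j Hj; rewrite Ha; [ring |].
    apply Rmult_le_reg_r with (INR n); auto.
    replace (INR j / INR n * INR n) with (INR j) by (field; lra).
    apply lt_INR in Hj; rewrite mult_INR in Hj; simpl (INR 2) in Hj; lra. }
unfold cosine_sum; generalize (2 * n)%nat; intros m.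
induction m as [|m IH].
- simpl; replace (0 / INR n) with 0 by (field; lra).
  rewrite !Rmult_0_l, cos_0, Rmult_assoc, sqrt_sqrt by (left; apply Rdiv_lt_0_compat; lra).
  field; lra.
- rewrite !tech5, IH, Rmult_assoc, Ttilde_mult by lia; field; lra.
Qed.

(** Evenness allows the sum to run over the nodes of step [/ INR n] from -2 to 2. A cutoff vanishing
    beyond both ends then leaves no boundary terms in the summations by parts. *)
Lemma cosine_sum_shift a n theta :
  (1 <= n)%nat -> (forall t, a (- t) = a t) ->
  cosine_sum a n theta =
  sum_f_R0 (fun j => a (-2 + INR j * / INR n) * cos (INR j * theta + - (2 * INR n * theta)))
           (4 * n).
Proof.
intros Hn Ha.
assert (Hn' : 0 < INR n) by (apply lt_0_INR; lia).
replace (4 * n)%nat with (2 * (2 * n))%nat by lia.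
rewrite (sum_eq _ (fun j => (fun t => a (t / INR n) * cos (t * theta))
                              (INR j - INR (2 * n)))).
2:{ intros j _; cbv beta; rewrite mult_INR; simpl (INR 2).
    f_equal; f_equal; [field; lra | ring]. }
rewrite (sum_even (fun t => a (t / INR n) * cos (t * theta))).
- unfold cosine_sum; f_equal; unfold Rdiv; rewrite !Rmult_0_l, cos_0; ring.
- intros t; replace (- t / INR n) with (- (t / INR n)) by (field; lra).
  replace (- t * theta) with (- (t * theta)) by ring; rewrite Ha, cos_neg; reflexivity.
Qed.

(** * Lower bounds for the sine factors and decay of the kernel *)

Lemma sin_ge_third x : 0 <= x <= PI / 2 -> x / 3 <= sin x.
Proof.
intros [Hx HxP]; pose proof PI_4 as H4.
assert (Hx2 : x * x <= 4).
{ replace 4 with (2 * 2) by ring; apply Rmult_le_compat; lra. }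
(* The Taylor polynomial [x - x^3 / 6] lies below the sine, and it is at least [x / 3] because
   [x^2 <= 4]. *)
apply Rle_trans with (sin_approx x (2 * 0 + 1)).
2:{ apply sin_bound; lra. }
unfold sin_approx, sin_term; simpl.
assert (0 <= x * (4 - x * x)) by (apply Rmult_le_pos; lra).
lra.
Qed.

Lemma abs_sin_half_diff al be :
  0 <= al <= PI -> 0 <= be <= PI -> Rabs (al - be) / 3 <= Rabs (2 * sin ((al - be) / 2)).
Proof.
intros Ha Hb; pose proof PI_RGT_0.
rewrite Rabs_mult, (Rabs_pos_eq 2) by lra.
destruct (Rle_dec 0 (al - be)) as [Hs|Hs].
- rewrite (Rabs_pos_eq (al - be)) by lra.
  assert (H1 : (al - be) / 2 / 3 <= sin ((al - be) / 2)) by (apply sin_ge_third; lra).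
  pose proof (Rle_abs (sin ((al - be) / 2))); lra.
- rewrite (Rabs_left (al - be)) by lra.
  assert (H1 : (- (al - be) / 2) / 3 <= sin (- (al - be) / 2)) by (apply sin_ge_third; lra).
  replace (- (al - be) / 2) with (- ((al - be) / 2)) in H1 by lra.
  rewrite sin_neg in H1; pose proof (Rle_abs (- sin ((al - be) / 2))).
  rewrite Rabs_Ropp in H0; lra.
Qed.

(** The addition formulas for the half-angles have two nonnegative terms, so the sine of the
    half-sum dominates that of the half-difference. The cosine sum at [al + be] thus decays at least
    at the rate given by [rho]. *)
Lemma abs_sin_half_sum al be :
  0 <= al <= PI -> 0 <= be <= PI -> Rabs (al - be) / 3 <= Rabs (2 * sin ((al + be) / 2)).
Proof.
intros Ha Hb; apply Rle_trans with (1 := abs_sin_half_diff al be Ha Hb).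
rewrite !Rabs_mult; apply Rmult_le_compat_l; [apply Rabs_pos |].
replace ((al - be) / 2) with (al / 2 - be / 2) by field.
replace ((al + be) / 2) with (al / 2 + be / 2) by field.
assert (0 <= sin (al / 2)) by (apply sin_ge_0; lra).
assert (0 <= sin (be / 2)) by (apply sin_ge_0; lra).
assert (0 <= cos (al / 2)) by (apply cos_ge_0; lra).
assert (0 <= cos (be / 2)) by (apply cos_ge_0; lra).
rewrite sin_minus, sin_plus.
assert (0 <= sin (al / 2) * cos (be / 2)) by (apply Rmult_le_pos; lra).
assert (0 <= cos (al / 2) * sin (be / 2)) by (apply Rmult_le_pos; lra).
rewrite (Rabs_pos_eq (_ + _)) by lra; apply Rabs_le; lra.
Qed.

Lemma Lker_deriv_bounded a lam k n x y :
  (1 <= n)%nat -> 0 <= lam -> deriv_bounded lam k 2 1 a ->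
  (forall t, a (- t) = a t) -> (forall t, 2 <= t -> a t = 0) ->
  -1 <= x <= 1 -> -1 <= y <= 1 ->
  (rho x y / 3) ^ k * Rabs (Lker a n x y)
    <= (4 * INR n + 1 + INR k) * (lam * (INR k + 2) / INR n) ^ k.
Proof.
intros Hn Hl Hd Ha Ha2 Hx Hy.
assert (Hn' : 0 < INR n) by (apply lt_0_INR; lia).
set (B := (4 * INR n + 1 + INR k) * (lam * (INR k + 2) / INR n) ^ k).
assert (HB : forall theta, rho x y / 3 <= Rabs (2 * sin (theta / 2)) ->
           (rho x y / 3) ^ k * Rabs (cosine_sum a n theta) <= B).
{ intros theta Ht; rewrite cosine_sum_shift by auto.
  apply Rle_trans with (Rabs (2 * sin (theta / 2)) ^ k *
    Rabs (sum_f_R0 (fun j => a (-2 + INR j * / INR n) *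
       cos (INR j * theta + - (2 * INR n * theta))) (4 * n))).
  - apply Rmult_le_compat_r; [apply Rabs_pos |].
    apply pow_incr; split; auto; unfold rho.
    pose proof (Rabs_pos (acos x - acos y)); lra.
  - replace B with ((INR (4 * n) + 1 + INR k) * 1 * (/ INR n * lam * (INR k + 2)) ^ k).
    + apply deriv_bounded_sum_cos with 2; auto; try lra.
      * left; apply Rinv_0_lt_compat, Hn'.
      * intros t Ht0; rewrite <- Ha; apply Ha2; lra.
      * intros t Ht0; apply Ha2; rewrite mult_INR in Ht0; simpl (INR 4) in Ht0.
        replace (-2 + (1 + 1 + 1 + 1) * INR n * / INR n) with 2 in Ht0 by (field; lra); lra.
    + unfold B; rewrite mult_INR, Rmult_1_r; simpl (INR 4); f_equal; [ring |].
      f_equal; unfold Rdiv; ring. }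
pose proof (acos_bound x) as Bx; pose proof (acos_bound y) as By.
specialize (HB (acos x - acos y)) as H1; specialize (HB (acos x + acos y)) as H2.
specialize (H1 (abs_sin_half_diff _ _ Bx By)); specialize (H2 (abs_sin_half_sum _ _ Bx By)).
rewrite Lker_cosine_sum by auto.
pose proof PI2_1 as HPI.
assert (Hr : 0 <= (rho x y / 3) ^ k).
{ apply pow_le; unfold rho; pose proof (Rabs_pos (acos x - acos y)); lra. }
assert (HB0 : 0 <= B).
{ apply Rle_trans with (2 := H1), Rmult_le_pos; auto using Rabs_pos. }
rewrite Rabs_mult, Rabs_pos_eq by (left; apply Rinv_0_lt_compat; lra).
apply Rmult_le_reg_l with (2 * PI); [lra |].
replace (2 * PI * ((rho x y / 3) ^ k * (/ (2 * PI) *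
   Rabs (cosine_sum a n (acos x - acos y) + cosine_sum a n (acos x + acos y)))))
  with ((rho x y / 3) ^ k *
   Rabs (cosine_sum a n (acos x - acos y) + cosine_sum a n (acos x + acos y)))
  by (field; lra).
(* Each cosine sum contributes one [B]; the prefactor [/ (2 * PI)] absorbs the resulting 2. *)
apply Rle_trans with (B + B).
- apply Rle_trans with ((rho x y / 3) ^ k * Rabs (cosine_sum a n (acos x - acos y))
   + (rho x y / 3) ^ k * Rabs (cosine_sum a n (acos x + acos y))); [| lra].
  rewrite <- Rmult_plus_distr_l; apply Rmult_le_compat_l; auto; apply Rabs_triang.
- replace (B + B) with (2 * B) by ring; apply Rmult_le_compat_r; lra.
Qed.

(** * The cutoff functions *)

(** It rises between 4/3 and 5/3, which leaves a margin of 1/3 on either side inside [[1, 2]] for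
    the total half-width of the averages. *)
Definition ramp (t : R) : R := Rmax 0 (Rmin 1 (3 * t - 4)).

Lemma ramp_lipschitz : lipschitz 3 ramp.
Proof.
intros x y; unfold ramp, Rmax, Rmin.
repeat destruct (Rle_dec _ _); unfold Rabs; repeat destruct (Rcase_abs _); lra.
Qed.

Lemma ramp_bounds t : 0 <= ramp t <= 1.
Proof. unfold ramp, Rmax, Rmin; repeat destruct (Rle_dec _ _); lra. Qed.

Lemma ramp_left t : t <= 4 / 3 -> ramp t = 0.
Proof. intros; unfold ramp, Rmax, Rmin; repeat destruct (Rle_dec _ _); lra. Qed.

Lemma ramp_right t : 5 / 3 <= t -> ramp t = 1.
Proof. intros; unfold ramp, Rmax, Rmin; repeat destruct (Rle_dec _ _); lra. Qed.

(** The sum of all half-widths from index [j] on; it starts at 1/3 and tends to 0. *)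
Definition log_tail (eps : R) (j : nat) : R := Rpower (ln (exp 1 + INR j)) (- eps) / 3.

Lemma ln_exp1_ge_1 u : 0 <= u -> 1 <= ln (exp 1 + u).
Proof.
intros Hu; rewrite <- (ln_exp 1) at 1; apply ln_le; [apply exp_pos | lra].
Qed.

Lemma ln_exp1_le u v : 0 <= u <= v -> ln (exp 1 + u) <= ln (exp 1 + v).
Proof.
intros Huv; pose proof (exp_pos 1); apply ln_le; lra.
Qed.

Lemma log_tail_0 eps : log_tail eps 0 = 1 / 3.
Proof.
unfold log_tail; simpl INR; rewrite Rplus_0_r, ln_exp; unfold Rpower.
rewrite ln_1, Rmult_0_r, exp_0; reflexivity.
Qed.

Lemma log_tail_lim eps : 0 < eps -> is_lim_seq (log_tail eps) 0.
Proof.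
intros He.
replace (Finite 0) with (Rbar_mult (/ 3) 0) by (simpl; f_equal; ring).
apply is_lim_seq_ext with (fun j => / 3 * exp (- eps * ln (ln (exp 1 + INR j)))).
{ intros j; unfold log_tail, Rpower; field. }
apply is_lim_seq_scal_l.
apply (is_lim_comp_seq exp _ m_infty 0).
- apply is_lim_exp_m.
- exists O; intros; discriminate.
- replace m_infty with (Rbar_mult (- eps) p_infty).
  2:{ simpl; destruct (Rle_dec 0 (- eps)); [exfalso; lra | reflexivity]. }
  apply is_lim_seq_scal_l.
  assert (Hln : forall u : nat -> R, is_lim_seq u p_infty ->
            is_lim_seq (fun j => ln (u j)) p_infty).
  { intros u Hu; apply (is_lim_comp_seq ln _ p_infty p_infty); auto.
    - apply is_lim_ln_p.
    - exists O; intros; discriminate. }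
  apply Hln, Hln.
  apply is_lim_seq_le_p_loc with INR; [| apply is_lim_seq_INR].
  exists O; intros j _; pose proof (exp_pos 1); lra.
Qed.

(* Mean value theorem for [t |-> ln (e + t) ^ (- eps)], whose derivative is
   [- eps / ((e + t) ln (e + t) ^ (1 + eps))]. *)
Lemma log_tail_step eps j :
  0 < eps ->
  0 < eps / (3 * (exp 1 + INR (S j)) * Rpower (ln (exp 1 + INR (S j))) (1 + eps))
    <= log_tail eps j - log_tail eps (S j).
Proof.
intros He; pose proof (exp_pos 1) as He1; pose proof (pos_INR j) as Hj.
assert (Hpos : forall t, 0 <= t -> 0 < (exp 1 + t) * Rpower (ln (exp 1 + t)) (1 + eps)).
{ intros t Ht; apply Rmult_lt_0_compat; [lra | apply exp_pos]. }
split.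
{ apply Rdiv_lt_0_compat; auto; rewrite Rmult_assoc.
  apply Rmult_lt_0_compat; [lra | apply Hpos, pos_INR]. }
set (g := fun t => Rpower (ln (exp 1 + t)) (- eps)).
set (g' := fun t => - eps / ((exp 1 + t) * Rpower (ln (exp 1 + t)) (1 + eps))).
assert (Hd : forall t, 0 <= t -> is_derive g t (g' t)).
{ intros t Ht; pose proof (ln_exp1_ge_1 t Ht).
  unfold g, g', Rpower; auto_derive; [repeat split; lra |].
  rewrite (Rmult_plus_distr_r 1 eps), !Rmult_1_l, exp_plus, exp_ln by lra.
  replace (- eps * ln (ln (exp 1 + t))) with (- (eps * ln (ln (exp 1 + t)))) by ring.
  rewrite exp_Ropp.
  pose proof (exp_pos (eps * ln (ln (exp 1 + t)))).
  field; repeat split; lra. }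
destruct (MVT_gen g (INR j) (INR (S j)) g') as [c [Hc E]].
{ rewrite S_INR, Rmin_left, Rmax_right by lra; intros t Ht; apply Hd; lra. }
{ rewrite S_INR, Rmin_left, Rmax_right by lra; intros t Ht.
  apply continuity_pt_filterlim, (ex_derive_continuous g); exists (g' t); apply Hd; lra. }
rewrite S_INR in Hc |- *; rewrite Rmin_left, Rmax_right in Hc by lra.
unfold log_tail; rewrite S_INR in E |- *; fold (g (INR j)); fold (g (INR j + 1)).
(* The denominator of [g'] increases, so its value at [c <= j + 1] is at most the one at [j + 1]. *)
apply Rle_trans with (- g' c / 3); [| lra].
unfold g'; replace (- (- eps / ((exp 1 + c) * Rpower (ln (exp 1 + c)) (1 + eps))) / 3)
  with (eps / (3 * ((exp 1 + c) * Rpower (ln (exp 1 + c)) (1 + eps))))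
  by (pose proof (exp_pos ((1 + eps) * ln (ln (exp 1 + c)))); unfold Rpower; field; lra).
apply Rmult_le_compat_l; [lra |].
pose proof (Hpos c ltac:(lra)).
apply Rinv_le_contravar; [lra |].
rewrite Rmult_assoc; apply Rmult_le_compat_l; [lra |].
apply Rmult_le_compat; [lra | left; apply exp_pos | lra |].
apply Rle_Rpower_l; [lra |].
pose proof (ln_exp1_ge_1 c ltac:(lra)); split; [lra | apply ln_exp1_le; lra].
Qed.

Lemma log_tail_decr eps : 0 < eps -> forall j, log_tail eps (S j) < log_tail eps j.
Proof. intros He j; pose proof (log_tail_step eps j He); lra. Qed.

(** Inverts [log_tail_step], with [exp 1 <= 3] giving [INR j + 4]. Putting [u] in the logarithm
    makes the factor uniform over all indices [j] below [u]. *)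
Lemma log_tail_inv_step eps j u :
  0 < eps -> INR (S j) <= u ->
  / (log_tail eps j - log_tail eps (S j))
    <= 3 * (INR j + 4) * (Rpower (ln (exp 1 + u)) (1 + eps) / eps).
Proof.
intros He Hu; destruct (log_tail_step eps j He) as [H1 H2].
apply Rle_trans with (1 := Rinv_le_contravar _ _ H1 H2).
pose proof exp_le_3; pose proof (exp_pos 1); pose proof (pos_INR j); rewrite S_INR in *.
rewrite Rinv_div; unfold Rdiv; rewrite <- !Rmult_assoc.
apply Rmult_le_compat_r; [left; apply Rinv_0_lt_compat, He |].
apply Rmult_le_compat; [lra | left; apply exp_pos | lra |].
apply Rle_Rpower_l; [lra |].
pose proof (ln_exp1_ge_1 (INR j + 1) ltac:(lra)); split; [lra | apply ln_exp1_le; lra].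
Qed.

Definition smooth_step (eps : R) : R -> R := averages_lim (log_tail eps) ramp 0.

Lemma smooth_step_left eps t : 0 < eps -> t <= 1 -> smooth_step eps t = 0.
Proof.
intros He Ht; apply Rle_antisym;
  apply (averages_lim_bounds (log_tail eps) 3 ramp 0 t 0 0);
  auto using log_tail_decr, log_tail_lim, ramp_lipschitz; try lra;
  intros s Hs; rewrite log_tail_0 in Hs; apply Rabs_le_between in Hs;
  rewrite ramp_left; lra.
Qed.

Lemma smooth_step_right eps t : 0 < eps -> 2 <= t -> smooth_step eps t = 1.
Proof.
intros He Ht; apply Rle_antisym;
  apply (averages_lim_bounds (log_tail eps) 3 ramp 0 t 1 1);
  auto using log_tail_decr, log_tail_lim, ramp_lipschitz; try lra;
  intros s Hs; rewrite log_tail_0 in Hs; apply Rabs_le_between in Hs;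
  rewrite ramp_right; lra.
Qed.

(* Equals [PI / 2] times [smooth_step eps (al * |t|)]. *)
Definition step_angle (eps al t : R) : R :=
  PI / 2 * (smooth_step eps (al * t) + smooth_step eps (- al * t)).

Lemma step_angle_even eps al t : step_angle eps al (- t) = step_angle eps al t.
Proof.
unfold step_angle.
replace (al * - t) with (- al * t) by ring; replace (- al * - t) with (al * t) by ring; ring.
Qed.

Lemma step_angle_near eps al t :
  0 < eps -> 0 < al -> 0 <= t -> al * t <= 1 -> step_angle eps al t = 0.
Proof.
intros He Hal Ht H; pose proof (Rmult_le_pos al t); unfold step_angle.
rewrite !smooth_step_left by lra; ring.
Qed.

Lemma step_angle_far eps al t :
  0 < eps -> 0 < al -> 2 <= al * t -> step_angle eps al t = PI / 2.
Proof.
intros He Hal H; unfold step_angle.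
rewrite smooth_step_right, smooth_step_left by lra; ring.
Qed.

(** The angle of the sine factor of [band_pass] at [t / 2] is that of its cosine factor at [t]; this
    yields the sum of squares for type (c). *)
Lemma step_angle_rescale eps t :
  0 < eps -> 1 <= t -> step_angle eps 2 (t / 2) = step_angle eps 1 t.
Proof.
intros He Ht; unfold step_angle.
rewrite !(smooth_step_left eps (- _ * _)) by lra.
replace (2 * (t / 2)) with (1 * t) by field; reflexivity.
Qed.

Lemma deriv_bounded_step_angle eps al k u :
  0 < eps -> 0 <= al <= 2 -> INR k <= u ->
  let lam := 100 * (Rpower (ln (exp 1 + u)) (1 + eps) / eps) in
  deriv_bounded lam k 1 1 (fun t => cos (step_angle eps al t)) /\
  deriv_bounded lam k 1 1 (fun t => sin (step_angle eps al t)).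
Proof.
intros He Hal Hu lam.
set (M := Rpower (ln (exp 1 + u)) (1 + eps) / eps) in lam.
assert (HM : 0 < M) by (apply Rdiv_lt_0_compat; [apply exp_pos | lra]).
destruct k as [|k].
{ split; (split; [intros x | exact I]); apply Rabs_le.
  - pose proof (COS_bound (step_angle eps al x)); lra.
  - pose proof (SIN_bound (step_angle eps al x)); lra. }
pose proof (log_tail_decr eps He) as Ht; pose proof (log_tail_lim eps He) as Hl.
pose proof ramp_lipschitz as Hr.
pose proof PI_4; pose proof PI_RGT_0.
assert (Hstep : forall j, (j < S k)%nat ->
  / (log_tail eps j - log_tail eps (S j)) <= 3 * (INR j + 4) * M).
{ intros j Hj; apply log_tail_inv_step; auto.
  apply Rle_trans with (2 := Hu), le_INR; lia. }
(* The first derivative is split off, since [deriv_bounded_averages_lim] has exponent [INR k] and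
   the exponent 1 belongs to index 1. Here [12 * M] is the bound on the first inverse half-width,
   and [24 * M] covers the others through [3 * (j + 4) <= 24 * j] for [j >= 1]. *)
set (s' := averages_lim_deriv (log_tail eps) ramp 0).
assert (Hd : forall x, is_derive (smooth_step eps) x (s' x)).
{ intros x; apply is_derive_averages_lim with 3; auto; lra. }
assert (Hs' : deriv_bounded (24 * M) k 1 (12 * M) s').
{ apply deriv_bounded_mono with (24 * M) 1 (/ (log_tail eps 0 - log_tail eps 1)); try lra.
  - specialize (Hstep O ltac:(lia)); simpl INR in Hstep; lra.
  - apply deriv_bounded_averages_lim_deriv with 3; auto; try lra.
    apply (deriv_bounded_averages_lim (log_tail eps) 3 ramp (24 * M) k 1);
      auto using ramp_bounds; try lra.
    intros j Hj; apply Rle_trans with (1 := Hstep j ltac:(lia)).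
    assert (1 <= INR j) by (apply (le_INR 1); lia).
    replace (24 * M * INR j) with (24 * INR j * M) by ring.
    apply Rmult_le_compat_r; lra. }
assert (Hscal : forall c, Rabs c <= 2 ->
  deriv_bounded lam k 1 (2 * (12 * M)) (fun t => c * s' (c * t))).
{ intros c Hc; pose proof (Rabs_pos c).
  apply deriv_bounded_mono with (Rabs c * (24 * M)) 1 (Rabs c * (12 * M)); try lra.
  - split; [apply Rmult_le_pos; lra |].
    apply Rle_trans with (2 * (24 * M)); [apply Rmult_le_compat_r; lra | unfold lam; lra].
  - apply Rmult_le_compat_r; lra.
  - apply (deriv_bounded_scal _ _ _ _ (fun t => s' (c * t))), deriv_bounded_comp_linear, Hs'. }
apply deriv_bounded_cos_sin with (C := Rabs (PI / 2) * (2 * (12 * M) + 2 * (12 * M)))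
  (f' := fun t => PI / 2 * (al * s' (al * t) + - al * s' (- al * t))).
- unfold lam; lra.
(* Source of the constant 100: [PI / 2 <= 2] times two terms of size [24 * M] gives [96 * M]. *)
- rewrite Rabs_pos_eq by lra.
  apply Rle_trans with (2 * (2 * (12 * M) + 2 * (12 * M)));
    [apply Rmult_le_compat_r; lra |].
  unfold lam; lra.
- intros t; apply (is_derive_scal (fun t => smooth_step eps (al * t) + smooth_step eps (- al * t))).
  apply @is_derive_plus.
  + apply (is_derive_comp (smooth_step eps) (fun t => al * t)); auto.
    auto_derive; auto; ring.
  + apply (is_derive_comp (smooth_step eps) (fun t => - al * t)); auto.
    auto_derive; auto; ring.
- intros j Hj; injection Hj as ->.
  apply deriv_bounded_scal, deriv_bounded_plus; apply Hscal.
  + rewrite Rabs_pos_eq; lra.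
  + rewrite Rabs_Ropp, Rabs_pos_eq; lra.
Qed.

(** * Sub-exponential decay *)

Lemma Rpower_ln_exp1_ge_1 eps u : 0 < eps -> 0 <= u -> 1 <= Rpower (ln (exp 1 + u)) (1 + eps).
Proof.
intros He Hu; pose proof (ln_exp1_ge_1 u Hu).
apply Rle_trans with (Rpower (ln (exp 1 + u)) 0); [rewrite Rpower_O; lra |].
apply Rle_Rpower; lra.
Qed.

Lemma Lker_subexponential a eps n x y :
  0 < eps <= 1 ->
  (forall k u, INR k <= u ->
     deriv_bounded (100 * (Rpower (ln (exp 1 + u)) (1 + eps) / eps)) k 2 1 a) ->
  (forall t, a (- t) = a t) -> (forall t, 2 <= t -> a t = 0) ->
  (1 <= n)%nat -> -1 <= x <= 1 -> -1 <= y <= 1 ->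
  Rabs (Lker a n x y) <=
    5 * exp 1 * INR n *
    exp (- (exp (-2) / 900 * eps * INR n * rho x y)
           / Rpower (ln (exp 1 + INR n * rho x y)) (1 + eps)).
Proof.
intros He Ha Heven Hfar Hn Hx Hy.
assert (Hn1 : 1 <= INR n) by (apply (le_INR 1); lia).
assert (Hrho : 0 <= rho x y) by (unfold rho; apply Rabs_pos).
set (u := INR n * rho x y).
assert (Hu : 0 <= u) by (apply Rmult_le_pos; lra).
pose proof (Rpower_ln_exp1_ge_1 eps u ltac:(lra) Hu) as HQ.
set (Q := Rpower (ln (exp 1 + u)) (1 + eps)) in *.
assert (He2 : 0 < exp (-2) <= 1).
{ split; [apply exp_pos | rewrite <- exp_0; left; apply exp_increasing; lra]. }
(* With about [mu] summations by parts, each must gain the factor [exp (-2)], that is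
   [300 * Q * (k + 2) <= exp (-2) * eps * u]. For [1 <= k <= mu] one has [k + 2 <= 3 * mu], hence
   900. *)
set (mu := exp (-2) / 900 * eps * u / Q).
replace (- (exp (-2) / 900 * eps * INR n * rho x y) / Q) with (- mu)
  by (unfold mu, u; field; lra).
assert (Hmu0 : 0 <= mu).
{ apply Rmult_le_pos; [repeat apply Rmult_le_pos; lra | left; apply Rinv_0_lt_compat; lra]. }
assert (HmuQ : mu * Q = exp (-2) / 900 * eps * u) by (unfold mu; field; lra).
(* This ensures [INR k <= u] for the order [k] chosen below, as the derivative bounds on [a]
   require. *)
assert (Hmuu : mu <= u).
{ assert (H1 : mu * 1 <= mu * Q) by (apply Rmult_le_compat_l; lra).
  assert (H2 : exp (-2) / 900 * eps * u <= 1 * 1 * u).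
  { apply Rmult_le_compat_r; [lra |]; apply Rmult_le_compat; lra. }
  lra. }
destruct (nfloor_ex mu Hmu0) as [k [Hk1 Hk2]].
assert (Hlam : 0 <= 100 * (Q / eps)).
{ apply Rmult_le_pos; [lra | left; apply Rdiv_lt_0_compat; lra]. }
pose proof (Lker_deriv_bounded a _ k n x y Hn Hlam (Ha k u ltac:(lra)) Heven Hfar Hx Hy) as HL.
assert (HLk : Rabs (Lker a n x y) <= (4 * INR n + 1 + INR k) * exp (-2) ^ k).
(* For [k = 0] both powers are 1. For [k >= 1] one has [mu >= 1], which forces [rho x y > 0] and
   permits division by it. *)
{ destruct k as [|k]; [simpl in HL |- *; lra |].
  assert (H1 : 1 <= INR (S k)) by (rewrite S_INR; pose proof (pos_INR k); lra).
  set (K := INR (S k)) in *.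
  assert (Hrho' : 0 < rho x y).
  { destruct Hrho as [|E]; auto; exfalso; unfold u in Hmuu; rewrite <- E in Hmuu; lra. }
  apply Rmult_le_reg_l with ((rho x y / 3) ^ S k); [apply pow_lt; lra |].
  apply Rle_trans with (1 := HL).
  replace ((rho x y / 3) ^ S k * ((4 * INR n + 1 + K) * exp (-2) ^ S k))
    with ((4 * INR n + 1 + K) * (exp (-2) * (rho x y / 3)) ^ S k)
    by (rewrite Rpow_mult_distr; ring).
  apply Rmult_le_compat_l; [lra |].
  apply pow_incr; split.
  { apply Rmult_le_pos; [apply Rmult_le_pos; lra | left; apply Rinv_0_lt_compat; lra]. }
  apply Rmult_le_reg_r with (eps * INR n); [apply Rmult_lt_0_compat; lra |].
  replace (100 * (Q / eps) * (K + 2) / INR n * (eps * INR n)) with (100 * ((K + 2) * Q))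
    by (field; lra).
  replace (exp (-2) * (rho x y / 3) * (eps * INR n)) with (300 * (mu * Q))
    by (rewrite HmuQ; unfold u; field).
  replace (300 * (mu * Q)) with (100 * (3 * mu * Q)) by ring.
  apply Rmult_le_compat_l; [lra |]; apply Rmult_le_compat_r; lra. }
apply Rle_trans with (1 := HLk).
(* One factor [exp (- k)] absorbs the growth [1 + k] of the number of summands; the other gives the
   decay, up to a factor [exp 1] because [mu < k + 1]. *)
assert (Hek : exp (-2) ^ k = exp (- INR k) * exp (- INR k)).
{ rewrite <- exp_plus, <- Rpower_pow by lra; unfold Rpower; rewrite ln_exp; f_equal; ring. }
assert (Hk : (1 + INR k) * exp (- INR k) <= 1).
{ rewrite exp_Ropp; pose proof (exp_pos (INR k)).
  apply Rmult_le_reg_r with (exp (INR k)); auto.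
  rewrite Rmult_assoc, Rinv_l, Rmult_1_l, Rmult_1_r by lra; apply exp_ineq1_le. }
assert (Hexp : exp (- INR k) <= exp 1 * exp (- mu)).
{ rewrite <- exp_plus; left; apply exp_increasing; lra. }
pose proof (pos_INR k); pose proof (exp_pos (- INR k)).
rewrite Hek, <- Rmult_assoc.
apply Rle_trans with (5 * INR n * exp (- INR k)).
- apply Rmult_le_compat_r; [lra |].
  apply Rle_trans with (5 * INR n * ((1 + INR k) * exp (- INR k))).
  + rewrite <- Rmult_assoc; apply Rmult_le_compat_r; [lra |].
    assert (0 <= (INR n - 1) * INR k) by (apply Rmult_le_pos; lra); lra.
  + rewrite <- (Rmult_1_r (5 * INR n)) at 2; apply Rmult_le_compat_l; lra.
- replace (5 * exp 1 * INR n * exp (- mu)) with (5 * INR n * (exp 1 * exp (- mu))) by ring.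
  apply Rmult_le_compat_l; lra.
Qed.

(** * Admissibility of the two cutoffs and the kernel estimate *)

Definition low_pass (eps t : R) : R := cos (step_angle eps 1 t).

Definition band_pass (eps t : R) : R := sin (step_angle eps 2 t) * cos (step_angle eps 1 t).

(** The exponent is relaxed from 1 to 2, the value that the product [band_pass] has, so that one
    kernel estimate serves both cutoffs. *)
Lemma deriv_bounded_low_pass eps k u :
  0 < eps -> INR k <= u ->
  deriv_bounded (100 * (Rpower (ln (exp 1 + u)) (1 + eps) / eps)) k 2 1 (low_pass eps).
Proof.
intros He Hu.
assert (0 < Rpower (ln (exp 1 + u)) (1 + eps) / eps)
  by (apply Rdiv_lt_0_compat; [apply exp_pos | lra]).
apply deriv_bounded_mono with (100 * (Rpower (ln (exp 1 + u)) (1 + eps) / eps)) 1 1; try lra.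
apply deriv_bounded_step_angle; lra.
Qed.

Lemma deriv_bounded_band_pass eps k u :
  0 < eps -> INR k <= u ->
  deriv_bounded (100 * (Rpower (ln (exp 1 + u)) (1 + eps) / eps)) k 2 1 (band_pass eps).
Proof.
intros He Hu.
assert (0 < Rpower (ln (exp 1 + u)) (1 + eps) / eps)
  by (apply Rdiv_lt_0_compat; [apply exp_pos | lra]).
apply deriv_bounded_mono with
  (100 * (Rpower (ln (exp 1 + u)) (1 + eps) / eps)) (1 + 1) (1 * 1); try lra.
apply deriv_bounded_mult; apply deriv_bounded_step_angle; lra.
Qed.

Lemma low_pass_far eps t : 0 < eps -> 2 <= t -> low_pass eps t = 0.
Proof. intros He Ht; unfold low_pass; rewrite step_angle_far by lra; apply cos_PI2. Qed.

Lemma band_pass_far eps t : 0 < eps -> 2 <= t -> band_pass eps t = 0.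
Proof.
intros He Ht; unfold band_pass; rewrite (step_angle_far eps 1) by lra; rewrite cos_PI2; ring.
Qed.

Lemma low_pass_admissible eps : 0 < eps -> admissible TypeA (low_pass eps).
Proof.
intros He; split; [| split].
(* Smoothness asks for one order at a time, so [u = INR k] may vary with the order. *)
- intros k; eapply deriv_bounded_ex_derive_n.
  apply (deriv_bounded_low_pass eps k (INR k)); lra.
- intros t Ht H; apply Rnot_lt_le; intros H2; apply H, low_pass_far; lra.
- intros t Ht; unfold low_pass; rewrite step_angle_near by lra; apply cos_0.
Qed.

Lemma band_pass_admissible eps : 0 < eps -> admissible TypeC (band_pass eps).
Proof.
intros He; split; [| split].
- intros k; eapply deriv_bounded_ex_derive_n.
  apply (deriv_bounded_band_pass eps k (INR k)); lra.
- intros t Ht H; split; apply Rnot_lt_le; intros H2; apply H.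
  + unfold band_pass; rewrite (step_angle_near eps 2) by lra; rewrite sin_0; ring.
  + apply band_pass_far; lra.
- intros t Ht; rewrite !pow2_abs; unfold band_pass.
  (* On [[1, 2]] the sine factor at [t] and the cosine factor at [t / 2] equal 1; the remaining two
     are the cosine and the sine of one angle. *)
  rewrite step_angle_rescale, (step_angle_far eps 2), (step_angle_near eps 1 (t / 2)) by lra.
  rewrite sin_PI2, cos_0.
  pose proof (sin2_cos2 (step_angle eps 1 t)) as E; unfold Rsqr in E; lra.
Qed.

Theorem theorem2p1 :
  exists c' : R, 0 < c' /\
  forall (eps : R), 0 < eps <= 1 ->
  forall ty : cutoff_type,
  exists a : R -> R, admissible ty a /\
  exists c : R, 0 < c /\
  forall (n : nat), (1 <= n)%nat ->
  forall x y : R, -1 <= x <= 1 -> -1 <= y <= 1 ->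
    Rabs (Lker a n x y) <=
      c * INR n * exp (- (c' * eps * INR n * rho x y)
                         / Rpower (ln (exp 1 + INR n * rho x y)) (1 + eps)).
Proof.
exists (exp (-2) / 900); split.
{ apply Rdiv_lt_0_compat; [apply exp_pos | lra]. }
intros eps He ty.
(* Type (c) is type (b) with one more condition, so [band_pass] serves both. *)
exists (match ty with TypeA => low_pass eps | _ => band_pass eps end); split.
{ destruct ty.
  - apply low_pass_admissible; lra.
  - destruct (band_pass_admissible eps) as [Hs [Hsupp _]]; [lra | split; auto].
  - apply band_pass_admissible; lra. }
exists (5 * exp 1); split; [pose proof (exp_pos 1); lra |].
intros n Hn x y Hx Hy; apply Lker_subexponential; auto.
- intros k u Hu; destruct ty; (apply deriv_bounded_low_pass || apply deriv_bounded_band_pass); lra.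
- intros t; destruct ty; unfold low_pass, band_pass; rewrite !step_angle_even; reflexivity.
- intros t Ht; destruct ty; (apply low_pass_far || apply band_pass_far); lra.
Qed.
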